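(* The point transformation $$x'=e^{t+v/2},\qquad t'=t,\qquad v'=2(\ln x-t)$$ leaves the equation $$v_t=\frac{x}{v_x}v_{xx}-1$$ invariant.
   Context: Subscripts denote partial derivatives. The equation is the form taken by $v_x=ux,\ v_t=\frac xu u_x$ after eliminating $u=v_x/x$. ''Leaves the equation invariant'' means: whenever $v$ is a smooth function on an open set $D\subset\{x>0\}$ with $v_x$ nowhere zero, such that $(x,t)\mapsto(e^{t+v(x,t)/2},t)$ is a diffeomorphism of $D$ onto an open set $D'$, and $v'$ is the function on $D'$ whose value at $(e^{t+v(x,t)/2},t)$ is $2(\ln x-t)$, then $v'$ satisfies $v'_{t'}=\frac{x'}{v'_{x'}}v'_{x'x'}-1$ on $D'$ if and only if $v$ satisfies $v_t=\frac{x}{v_x}v_{xx}-1$ on $D$. *)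

(* Defs.v *)
From Stdlib Require Import Reals.
From Coquelicot Require Import Coquelicot.
Open Scope R_scope.

(* A function on a planar domain is a total function R -> R -> R together with
   a domain D; its values outside D play no role.  For open D, the following
   says that partial derivatives of all orders exist and are continuous on D. *)
Definition smooth_on (D : R * R -> Prop) (f : R -> R -> R) : Prop :=
  forall x y : R, D (x, y) -> forall n : nat, ex_diff_n f n x y.

Definition smooth_map_on (D : R * R -> Prop) (F : R * R -> R * R) : Prop :=
  smooth_on D (fun x y => fst (F (x, y))) /\
  smooth_on D (fun x y => snd (F (x, y))).

Definition diffeomorphism (D D' : R * R -> Prop) (F : R * R -> R * R) : Prop :=
  smooth_map_on D F /\
  (forall p, D p -> D' (F p)) /\
  exists G : R * R -> R * R,
    smooth_map_on D' G /\
    (forall q, D' q -> D (G q)) /\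
    (forall p, D p -> G (F p) = p) /\
    (forall q, D' q -> F (G q) = q).

Definition d_x (v : R -> R -> R) (x t : R) : R := Derive (fun z => v z t) x.
Definition d_t (v : R -> R -> R) (x t : R) : R := Derive (fun s => v x s) t.
Definition d_xx (v : R -> R -> R) : R -> R -> R := d_x (d_x v).

(* [v_t = (x / v_x) v_xx - 1] on D.  As Derive and division are total, the
   first four clauses require that every term of the equation be meaningful. *)
Definition satisfies_equation (D : R * R -> Prop) (v : R -> R -> R) : Prop :=
  forall x t : R, D (x, t) ->
    ex_derive (fun z => v z t) x /\
    ex_derive (fun z => d_x v z t) x /\
    ex_derive (fun s => v x s) t /\
    d_x v x t <> 0 /\
    d_t v x t = x / d_x v x t * d_xx v x t - 1.

(* Main.v *)
Require Import Defs.
From Stdlib Require Import Reals Lra.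
From Coquelicot Require Import Coquelicot.
Open Scope R_scope.

(** The first component [X] of the inverse diffeomorphism, written in the new
    coordinates [(y, t) = (x', t')], satisfies on [D']
    [v (X y t) t = 2 (ln y - t)] and [v' y t = 2 (ln (X y t) - t)]:
    the transformation exchanges [ln x] and [t + v / 2], hence the roles of the
    space variable and of the unknown (a hodograph transformation).
    Differentiating the first identity implicitly gives [X_y] and [X_t], and
    the second one then expresses the derivatives of [v'] at [(y, t)] through
    those of [v] at [(X, t)]:
    - [v'_y = 4 / (y X v_x)] ([is_derive_image_y]),
    - [v'_t = -2 (2 + v_t) / (X v_x) - 2] ([is_derive_image_t]),
    - [v'_yy] from the first formula ([is_derive_image_yy]).

    Substituting, the defects of the two equations are proportional:
    [v'_t - (y v'_yy / v'_y - 1)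
       = - 2 / (X v_x) * (v_t - (X v_xx / v_x - 1))].
    The factor does not vanish, so the two equations are equivalent at
    corresponding points, and the diffeomorphism puts all points of [D] and
    [D'] in correspondence. *)

(** * Smooth functions on open planar domains *)

Lemma open_slice_fst (D : R * R -> Prop) (x t : R) :
  open D -> D (x, t) -> locally x (fun z => D (z, t)).
Proof.
  intros HD H.
  apply (locally_2d_1d_const_y (fun a b => D (a, b))).
  apply locally_2d_locally.
  apply filter_imp with (2 := HD _ H). now intros [a b].
Qed.

Lemma open_slice_snd (D : R * R -> Prop) (x t : R) :
  open D -> D (x, t) -> locally t (fun s => D (x, s)).
Proof.
  intros HD H.
  apply (locally_2d_1d_const_x (fun a b => D (a, b))).
  apply locally_2d_locally.
  apply filter_imp with (2 := HD _ H). now intros [a b].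
Qed.

Lemma smooth_on_is_derive_x (D : R * R -> Prop) (f : R -> R -> R) (x t : R) :
  smooth_on D f -> D (x, t) -> is_derive (fun z => f z t) x (d_x f x t).
Proof.
  intros Hf H. apply Derive_correct. now destruct (Hf x t H 1%nat) as (_ & h & _).
Qed.

Lemma smooth_on_is_derive_t (D : R * R -> Prop) (f : R -> R -> R) (x t : R) :
  smooth_on D f -> D (x, t) -> is_derive (fun s => f x s) t (d_t f x t).
Proof.
  intros Hf H. apply Derive_correct.
  now destruct (Hf x t H 1%nat) as (_ & _ & h & _).
Qed.

Lemma smooth_on_d_x (D : R * R -> Prop) (f : R -> R -> R) :
  smooth_on D f -> smooth_on D (d_x f).
Proof.
  intros Hf x t H n. now destruct (Hf x t H (S n)) as (_ & _ & _ & h & _).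
Qed.

(** Continuity of [d_x f] near the point makes [f] totally differentiable
    there, which the chain rule along a curve requires. *)
Lemma smooth_on_chain_rule (D : R * R -> Prop) (f : R -> R -> R)
    (c : R -> R) (t dc : R) :
  open D -> smooth_on D f -> D (c t, t) -> is_derive c t dc ->
  is_derive (fun s => f (c s) s) t (d_x f (c t) t * dc + d_t f (c t) t).
Proof.
  intros HD Hf H Hc.
  apply is_derive_Reals.
  replace (d_x f (c t) t * dc + d_t f (c t) t)
    with (d_x f (c t) t * dc + d_t f (c t) t * 1) by ring.
  apply (derivable_pt_lim_comp_2d f c (fun s => s)).
  - apply filterdiff_differentiable_pt_lim.
    apply (is_derive_filterdiff f (c t) t (d_x f)).
    + apply filter_imp with (2 := HD _ H).
      intros [a b] Hab. now apply (smooth_on_is_derive_x D).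
    + now apply (smooth_on_is_derive_t D).
    + apply continuity_2d_pt_filterlim.
      now destruct (smooth_on_d_x D f Hf _ _ H 0%nat).
  - now apply is_derive_Reals.
  - apply derivable_pt_lim_id.
Qed.

(** * Derivatives of the transformed function *)

(** The transformation solved for the old space variable: [X] is the first
    component of the inverse diffeomorphism. *)
Record hodograph (D D' : R * R -> Prop) (v v' X : R -> R -> R) : Prop := {
  source_open : open D;
  image_open : open D';
  source_smooth : smooth_on D v;
  source_nondegenerate : forall x t, D (x, t) -> d_x v x t <> 0;
  old_x_smooth : smooth_on D' X;
  old_x_in_source : forall y t, D' (y, t) -> D (X y t, t);
  old_x_pos : forall y t, D' (y, t) -> 0 < X y t;
  new_x_pos : forall y t, D' (y, t) -> 0 < y;
  source_value : forall y t, D' (y, t) -> v (X y t) t = 2 * (ln y - t);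
  image_value : forall y t, D' (y, t) -> v' y t = 2 * (ln (X y t) - t)
}.

Lemma hodograph_of_diffeomorphism (D D' : R * R -> Prop) (v v' : R -> R -> R)
    (G : R * R -> R * R) :
  let F := fun p => (exp (snd p + v (fst p) (snd p) / 2), snd p) in
  open D -> (forall x t : R, D (x, t) -> 0 < x) -> smooth_on D v ->
  (forall x t : R, D (x, t) -> d_x v x t <> 0) ->
  open D' -> smooth_map_on D' G -> (forall q, D' q -> D (G q)) ->
  (forall q, D' q -> F (G q) = q) ->
  (forall x t : R, D (x, t) -> v' (exp (t + v x t / 2)) t = 2 * (ln x - t)) ->
  hodograph D D' v v' (fun y t => fst (G (y, t))).
Proof.
  intros F HD Hpos Hv Hnz HD' [HG _] HGD HFG Hv'.
  assert (key : forall y t, D' (y, t) ->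
    D (fst (G (y, t)), t) /\ y = exp (t + v (fst (G (y, t))) t / 2)).
  { intros y t H.
    pose proof (HGD _ H) as H1. pose proof (HFG _ H) as H2.
    destruct (G (y, t)) as [x s]. unfold F in H2; simpl in *.
    injection H2 as H2 ->. now split. }
  split; try assumption.
  - intros y t H. now apply key.
  - intros y t H. apply (Hpos _ t). now apply key.
  - intros y t H. destruct (key y t H) as [_ ->]. apply exp_pos.
  - intros y t H. destruct (key y t H) as [_ E].
    rewrite E at 2. rewrite ln_exp. field.
  - intros y t H. destruct (key y t H) as [H1 E].
    rewrite E at 1. now apply Hv'.
Qed.

Section Derivatives.

Context {D D' : R * R -> Prop} {v v' X : R -> R -> R}
  (h : hodograph D D' v v' X) {y t : R} (Hyt : D' (y, t)).

Lemma is_derive_old_x_y :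
  is_derive (fun z => X z t) y (2 / (y * d_x v (X y t) t)).
Proof.
  pose proof (old_x_in_source _ _ _ _ _ h y t Hyt) as HX.
  pose proof (source_nondegenerate _ _ _ _ _ h _ _ HX) as Hnz.
  pose proof (new_x_pos _ _ _ _ _ h y t Hyt) as Hy.
  pose proof (smooth_on_is_derive_x D' X y t (old_x_smooth _ _ _ _ _ h) Hyt) as HdX.
  (* both sides of [v (X y t) t = 2 (ln y - t)] are differentiated in [y] *)
  assert (E1 : is_derive (fun z => v (X z t) t) y
                 (d_x X y t * d_x v (X y t) t)).
  { apply (is_derive_comp (fun z => v z t) (fun z => X z t)); [|exact HdX].
    apply (smooth_on_is_derive_x D); [apply (source_smooth _ _ _ _ _ h)|exact HX]. }
  assert (E2 : is_derive (fun z => v (X z t) t) y (2 / y)).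
  { apply (is_derive_ext_loc (fun z => 2 * (ln z - t))).
    - apply filter_imp with (2 := open_slice_fst _ _ _ (image_open _ _ _ _ _ h) Hyt).
      intros z Hz. symmetry. now apply (source_value _ _ _ _ _ h).
    - auto_derive; [exact Hy | field; lra]. }
  replace (2 / (y * d_x v (X y t) t)) with (d_x X y t); [exact HdX|].
  apply is_derive_unique in E1. apply is_derive_unique in E2.
  rewrite E1 in E2.
  apply Rmult_eq_reg_r with (d_x v (X y t) t); [|exact Hnz].
  rewrite E2. field. lra.
Qed.

Lemma is_derive_old_x_t :
  is_derive (fun s => X y s) t
    (- (2 + d_t v (X y t) t) / d_x v (X y t) t).
Proof.
  pose proof (old_x_in_source _ _ _ _ _ h y t Hyt) as HX.
  pose proof (source_nondegenerate _ _ _ _ _ h _ _ HX) as Hnz.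
  pose proof (smooth_on_is_derive_t D' X y t (old_x_smooth _ _ _ _ _ h) Hyt) as HdX.
  (* both sides of [v (X y t) t = 2 (ln y - t)] are differentiated in [t] *)
  pose proof (smooth_on_chain_rule D v (fun s => X y s) t _
    (source_open _ _ _ _ _ h) (source_smooth _ _ _ _ _ h) HX HdX) as E1.
  assert (E2 : is_derive (fun s => v (X y s) s) t (- 2)).
  { apply (is_derive_ext_loc (fun s => 2 * (ln y - s))).
    - apply filter_imp with (2 := open_slice_snd _ _ _ (image_open _ _ _ _ _ h) Hyt).
      intros s Hs. symmetry. now apply (source_value _ _ _ _ _ h).
    - auto_derive; [exact I | ring]. }
  replace (- (2 + d_t v (X y t) t) / d_x v (X y t) t) with (d_t X y t); [exact HdX|].
  apply is_derive_unique in E1. apply is_derive_unique in E2.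
  rewrite E1 in E2.
  apply Rmult_eq_reg_l with (d_x v (X y t) t); [|exact Hnz].
  field_simplify; [lra | exact Hnz].
Qed.

Lemma is_derive_image_y :
  is_derive (fun z => v' z t) y (4 / (y * X y t * d_x v (X y t) t)).
Proof.
  pose proof (old_x_in_source _ _ _ _ _ h y t Hyt) as HX.
  pose proof (source_nondegenerate _ _ _ _ _ h _ _ HX) as Hnz.
  pose proof (new_x_pos _ _ _ _ _ h y t Hyt) as Hy.
  pose proof (old_x_pos _ _ _ _ _ h y t Hyt) as HX0.
  pose proof is_derive_old_x_y as HdX.
  apply (is_derive_ext_loc (fun z => 2 * (ln (X z t) - t))).
  - apply filter_imp with (2 := open_slice_fst _ _ _ (image_open _ _ _ _ _ h) Hyt).
    intros z Hz. symmetry. now apply (image_value _ _ _ _ _ h).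
  - auto_derive.
    + split; [eexists; exact HdX | now split].
    + rewrite (is_derive_unique (fun z : R => X z t) _ _ HdX).
      field. repeat split; [exact Hnz | lra | lra].
Qed.

Lemma is_derive_image_t :
  is_derive (fun s => v' y s) t
    (- 2 * (2 + d_t v (X y t) t) / (X y t * d_x v (X y t) t) - 2).
Proof.
  pose proof (old_x_in_source _ _ _ _ _ h y t Hyt) as HX.
  pose proof (source_nondegenerate _ _ _ _ _ h _ _ HX) as Hnz.
  pose proof (old_x_pos _ _ _ _ _ h y t Hyt) as HX0.
  pose proof is_derive_old_x_t as HdX.
  apply (is_derive_ext_loc (fun s => 2 * (ln (X y s) - s))).
  - apply filter_imp with (2 := open_slice_snd _ _ _ (image_open _ _ _ _ _ h) Hyt).
    intros s Hs. symmetry. now apply (image_value _ _ _ _ _ h).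
  - auto_derive.
    + split; [eexists; exact HdX | now split].
    + rewrite (is_derive_unique (fun s : R => X y s) _ _ HdX).
      field. split; [exact Hnz | lra].
Qed.

End Derivatives.

Lemma is_derive_image_yy {D D' : R * R -> Prop} {v v' X : R -> R -> R}
    (h : hodograph D D' v v' X) {y t : R} (Hyt : D' (y, t)) :
  let x := X y t in
  let vx := d_x v x t in
  is_derive (fun z => d_x v' z t) y
    (- 4 * (x * vx + 2 + 2 * x * d_xx v x t / vx) / (y * x * vx) ^ 2).
Proof.
  intros x vx.
  pose proof (old_x_in_source _ _ _ _ _ h y t Hyt) as HX.
  pose proof (source_nondegenerate _ _ _ _ _ h _ _ HX) as Hnz.
  pose proof (new_x_pos _ _ _ _ _ h y t Hyt) as Hy.
  pose proof (old_x_pos _ _ _ _ _ h y t Hyt) as HX0.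
  pose proof (is_derive_old_x_y h Hyt) as HdX.
  assert (Hdg : is_derive (fun z => d_x v (X z t) t) y
                  (2 / (y * vx) * d_xx v x t)).
  { apply (is_derive_comp (fun z => d_x v z t) (fun z => X z t)); [|exact HdX].
    apply (smooth_on_is_derive_x D); [|exact HX].
    apply smooth_on_d_x, (source_smooth _ _ _ _ _ h). }
  apply (is_derive_ext_loc (fun z => 4 / (z * X z t * d_x v (X z t) t))).
  - apply filter_imp with (2 := open_slice_fst _ _ _ (image_open _ _ _ _ _ h) Hyt).
    intros z Hz. symmetry. apply is_derive_unique. now apply (is_derive_image_y h).
  - fold x in HX0. fold x in Hnz. fold vx in Hnz.
    (* naming the inner function keeps its derivative in the form of [Hdg] *)
    set (g := fun z => d_x v (X z t) t) in *.
    change (is_derive (fun z => 4 / (z * X z t * g z)) y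
      (- 4 * (x * vx + 2 + 2 * x * d_xx v x t / vx) / (y * x * vx) ^ 2)).
    auto_derive.
    + repeat split; [eexists; exact HdX | eexists; exact Hdg |].
      change (y * x * vx <> 0).
      repeat apply Rmult_integral_contrapositive_currified; lra || exact Hnz.
    + rewrite (is_derive_unique (fun z : R => X z t) _ _ HdX).
      rewrite (is_derive_unique (fun z : R => g z) _ _ Hdg).
      change (g y) with vx. fold x. fold vx.
      field. repeat split; [exact Hnz | lra | lra].
Qed.

(** * Equivalence of the two equations *)

Lemma hodograph_equation_iff {D D' : R * R -> Prop} {v v' X : R -> R -> R}
    (h : hodograph D D' v v' X) {y t : R} (Hyt : D' (y, t)) :
  let x := X y t in
  d_t v' y t = y / d_x v' y t * d_xx v' y t - 1 <->
  d_t v x t = x / d_x v x t * d_xx v x t - 1.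
Proof.
  intros x.
  pose proof (source_nondegenerate _ _ _ _ _ h _ _
    (old_x_in_source _ _ _ _ _ h y t Hyt)) as Hnz.
  pose proof (new_x_pos _ _ _ _ _ h y t Hyt) as Hy.
  pose proof (old_x_pos _ _ _ _ _ h y t Hyt) as HX0.
  assert (E1 : d_x v' y t = _)
    by exact (is_derive_unique _ _ _ (is_derive_image_y h Hyt)).
  assert (E2 : d_t v' y t = _)
    by exact (is_derive_unique _ _ _ (is_derive_image_t h Hyt)).
  assert (E3 : d_xx v' y t = _)
    by exact (is_derive_unique _ _ _ (is_derive_image_yy h Hyt)).
  fold x in Hnz, HX0, E1, E2, E3.
  assert (defect : d_t v' y t - (y / d_x v' y t * d_xx v' y t - 1)
    = - (2 / (x * d_x v x t))
      * (d_t v x t - (x / d_x v x t * d_xx v x t - 1))).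
  { rewrite E1, E2, E3. field. repeat split; [exact Hnz | lra | lra]. }
  assert (Hfactor : - (2 / (x * d_x v x t)) <> 0).
  { apply Ropp_neq_0_compat. unfold Rdiv.
    apply Rmult_integral_contrapositive_currified; [lra|].
    apply Rinv_neq_0_compat.
    apply Rmult_integral_contrapositive_currified; [lra | exact Hnz]. }
  split; intros E.
  - apply Rminus_diag_eq in E. rewrite defect in E.
    apply Rmult_integral in E. destruct E as [E|E]; [contradiction|].
    now apply Rminus_diag_uniq.
  - apply Rminus_diag_eq in E. rewrite E, Rmult_0_r in defect.
    now apply Rminus_diag_uniq.
Qed.

Theorem mainTheorem11 :
  forall (D D' : R * R -> Prop) (v v' : R -> R -> R),
    open D ->
    (forall x t : R, D (x, t) -> 0 < x) ->
    smooth_on D v ->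
    (forall x t : R, D (x, t) -> d_x v x t <> 0) ->
    open D' ->
    diffeomorphism D D' (fun p => (exp (snd p + v (fst p) (snd p) / 2), snd p)) ->
    (forall x t : R, D (x, t) -> v' (exp (t + v x t / 2)) t = 2 * (ln x - t)) ->
    (satisfies_equation D' v' <-> satisfies_equation D v).
Proof.
  intros D D' v v' HD Hpos Hv Hnz HD' (_ & HFD & G & HG & HGD & HGF & HFG) Hv'.
  pose proof (hodograph_of_diffeomorphism D D' v v' G
    HD Hpos Hv Hnz HD' HG HGD HFG Hv') as h.
  split; intros Hsat.
  - intros x t H.
    pose proof (HFD _ H) as H'. pose proof (HGF _ H) as EG. simpl in H', EG.
    repeat split.
    + eexists. now apply (smooth_on_is_derive_x D).
    + eexists. apply (smooth_on_is_derive_x D); [now apply smooth_on_d_x | exact H].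
    + eexists. now apply (smooth_on_is_derive_t D).
    + now apply Hnz.
    + pose proof (proj1 (hodograph_equation_iff h H')) as E.
      cbv beta zeta in E. rewrite EG in E. simpl in E.
      apply E. now apply Hsat.
  - intros y t H.
    pose proof (old_x_in_source _ _ _ _ _ h y t H) as HX.
    pose proof (new_x_pos _ _ _ _ _ h y t H) as Hy.
    pose proof (old_x_pos _ _ _ _ _ h y t H) as HX0.
    repeat split.
    + eexists. now apply (is_derive_image_y h).
    + eexists. now apply (is_derive_image_yy h).
    + eexists. now apply (is_derive_image_t h).
    + assert (E1 : d_x v' y t = _)
        by exact (is_derive_unique _ _ _ (is_derive_image_y h H)).
      rewrite E1. unfold Rdiv.
      apply Rmult_integral_contrapositive_currified; [lra|].
      apply Rinv_neq_0_compat.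
      repeat apply Rmult_integral_contrapositive_currified; try lra.
      now apply Hnz.
    + apply (hodograph_equation_iff h H). now apply Hsat.
Qed.
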